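(* For every positive integer $h$, the fifth positive element $\gamma_5(h)$ of the greedy $B_h$-set satisfies \[\gamma_5(h)\ge \tfrac18 h^4+\tfrac12 h^3 .\]
   Context: A set $\mathcal A$ of nonnegative integers is a $B_h$-set if every solution of $a_1+\dots+a_h=b_1+\dots+b_h$ with $a_i,b_i\in\mathcal A$ has $\{a_1,\dots,a_h\}=\{b_1,\dots,b_h\}$ as multisets. The greedy $B_h$-set $\{\gamma_0,\gamma_1(h),\gamma_2(h),\dots\}$ is defined by $\gamma_0=0$, $\gamma_1=1$, and, for $k\ge1$, $\gamma_{k+1}(h)$ is the smallest integer $x>\gamma_k(h)$ such that $\{\gamma_0,\gamma_1,\dots,\gamma_k(h),x\}$ is a $B_h$-set. *)

(* Defs.v *)
From mathcomp Require Import all_boot.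
From mathcomp Require Import zify.

Set Implicit Arguments.
Unset Strict Implicit.
Unset Printing Implicit Defensive.

Definition Bh_set (h : nat) (pT : predType nat) (A : pT) : Prop :=
  forall a b : h.-tuple nat, {subset a <= A} -> {subset b <= A} ->
    sumn a = sumn b -> perm_eq a b.

Definition greedy_candidate (h : nat) (gamma : nat -> nat) (k x : nat) : Prop :=
  gamma k < x /\ Bh_set h (rcons (mkseq gamma k.+1) x).

Definition is_greedy_Bh (h : nat) (gamma : nat -> nat) : Prop :=
  [/\ gamma 0 = 0, gamma 1 = 1 &
      forall k, 1 <= k ->
        greedy_candidate h gamma k (gamma k.+1) /\
        (forall x, greedy_candidate h gamma k x -> gamma k.+1 <= x)].

(* The rest of this file shows that, for every h, exactly one sequence
   satisfies is_greedy_Bh h. *)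

Lemma Bh_setP h (pT : predType nat) (A : pT) :
  Bh_set h A <-> (forall a b : seq nat, size a = h -> size b = h ->
    {subset a <= A} -> {subset b <= A} -> sumn a = sumn b -> perm_eq a b).
Proof.
split=> [H a b /eqP sa /eqP sb | H a b].
  exact: (H (Tuple sa) (Tuple sb)).
by apply: H; rewrite size_tuple.
Qed.

Lemma Bh_set01 h : Bh_set h [:: 0; 1].
Proof.
apply/Bh_setP => a b sa sb aA bA e.
have cnt s : {subset s <= [:: 0; 1]} ->
    (sumn s = count_mem 1 s) /\ (size s = count_mem 0 s + count_mem 1 s).
  elim: s => [//|x s IH] /= sub.
  have /IH [-> ->] : {subset s <= [:: 0; 1]}.
    by move=> y ys; apply: sub; rewrite inE ys orbT.
  have := sub x (mem_head _ _); rewrite !inE => /orP[] /eqP -> /=; lia.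
have [a1 a2] := cnt _ aA; have [b1 b2] := cnt _ bA.
apply/allP => x; rewrite mem_cat => xi.
have : x \in [:: 0; 1] by case/orP: xi; [apply: aA|apply: bA].
rewrite sa in a2; rewrite sb in b2; rewrite a1 b1 in e; rewrite e in a2.
rewrite !inE => /orP[] /eqP ->; apply/eqP; last exact: e.
by apply/eqP; rewrite -(eqn_add2r (count_mem 1 b)) -a2 -b2.
Qed.

Lemma sumn_bound (s : seq nat) M : all (leq^~ M) s -> sumn s <= size s * M.
Proof. by elim: s => [|x s IH] //= /andP[xM /IH]; lia. Qed.

Lemma Bh_set_extend h (s : seq nat) M x :
  0 \in s -> all (leq^~ M) s -> h * M < x -> Bh_set h s -> Bh_set h (rcons s x).
Proof.
move=> s0 sM hx /Bh_setP H; apply/Bh_setP => a b sa sb aA bA e.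
pose r (c : seq nat) := filter (predC1 x) c.
have perm_r c : perm_eq c (nseq (count_mem x c) x ++ r c).
  have -> : nseq (count_mem x c) x = filter (pred1 x) c.
    symmetry; rewrite -size_filter; apply/all_pred1P/filter_all.
  by rewrite perm_sym perm_filterC.
have rs c : {subset c <= rcons s x} -> {subset r c <= s}.
  move=> cA y; rewrite mem_filter /= => /andP[yx /cA].
  by rewrite mem_rcons inE (negPf yx).
have sumr c : sumn c = count_mem x c * x + sumn (r c).
  by rewrite (perm_sumn (perm_r c)) sumn_cat sumn_nseq mulnC.
have sizer c : size c = count_mem x c + size (r c).
  by rewrite {1}(perm_size (perm_r c)) size_cat size_nseq.
have smallr c : size c = h -> {subset c <= rcons s x} -> sumn (r c) < x.
  move=> sc cA; apply: leq_ltn_trans hx.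
  apply: (@leq_trans (size (r c) * M)).
    apply: sumn_bound; apply/allP => y yr; apply: (allP sM).
    exact: rs cA _ yr.
  by rewrite leq_mul2r -sc (sizer c) leq_addl orbT.
have ra := smallr a sa aA; have rb := smallr b sb bA.
have ea := sumr a; have eb := sumr b.
have ec : count_mem x a = count_mem x b by nia.
have za := sizer a; have zb := sizer b.
have P : perm_eq (nseq (count_mem x a) 0 ++ r a) (nseq (count_mem x a) 0 ++ r b).
  have sub c n : {subset r c <= s} -> {subset nseq n 0 ++ r c <= s}.
    move=> cs y; rewrite mem_cat => /orP[|/cs//].
    by rewrite mem_nseq => /andP[_ /eqP->].
  apply: H; rewrite ?size_cat ?size_nseq; 
    [by rewrite -za|by rewrite ec -zb|exact/sub/rs|exact/sub/rs|].
  rewrite !sumn_cat; congr (_ + _); apply/eqP.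
  by rewrite -(eqn_add2l (count_mem x a * x)) -ea ec -eb e.
rewrite perm_cat2l in P.
rewrite (permPl (perm_r a)) (permPr (perm_r b)) ec perm_cat2l //.
Qed.

Definition Bhb (h : nat) (s : seq nat) : bool :=
  [forall a : h.-tuple (seq_sub s), forall b : h.-tuple (seq_sub s),
    (sumn (map val a) == sumn (map val b)) ==> perm_eq (map val a) (map val b)].

Lemma BhbP h (s : seq nat) : reflect (Bh_set h s) (Bhb h s).
Proof.
apply: (iffP idP) => [H|/Bh_setP H].
  apply/Bh_setP => a b sa sb aA bA e.
  have lift c : size c = h -> {subset c <= s} ->
      exists t : h.-tuple (seq_sub s), map val t = c.
    move=> sc cs; have : exists u : seq (seq_sub s), map val u = c.
      elim: c cs {sc} => [|y c IH] cs; first by exists [::].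
      have [|u <-] := IH; first by move=> z zc; apply: cs; rewrite inE zc orbT.
      by exists (SeqSub (cs y (mem_head _ _)) :: u).
    case=> u eu; have su : size u == h by rewrite -sc -eu size_map.
    by exists (Tuple su).
  have [ta ea] := lift a sa aA; have [tb eb] := lift b sb bA.
  have /forallP/(_ tb)/implyP := forallP H ta.
  by rewrite ea eb e eqxx; apply.
apply/forallP => a; apply/forallP => b; apply/implyP => /eqP e.
apply: H; rewrite ?size_map ?size_tuple //.
all: by move=> y /mapP[z _ ->]; apply: valP.
Qed.

Lemma is_greedy_Bh_exists (h : nat) : exists gamma, is_greedy_Bh h gamma.
Proof.
pose next s := let m := last 0 s in
  m.+1 + find (fun d => Bhb h (rcons s (m.+1 + d))) (iota 0 (h * m).+1).
pose gs j := iter j (fun s => rcons s (next s)) [:: 0; 1].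
pose g k := if k is j.+1 then last 0 (gs j) else 0.
have gsS j : gs j.+1 = rcons (gs j) (next (gs j)) by [].
have gsE j : gs j = mkseq g j.+2.
  elim: j => [//|j IH].
  have mkS n : mkseq g n.+1 = rcons (mkseq g n) (g n).
    by rewrite /mkseq -addn1 iotaD map_cat cats1.
  by rewrite mkS -IH /g gsS last_rcons.
have inv j : [/\ 0 \in gs j, all (leq^~ (last 0 (gs j))) (gs j), Bh_set h (gs j)
   & Bh_set h (rcons (gs j) (next (gs j))) /\
     (forall x, last 0 (gs j) < x -> Bh_set h (rcons (gs j) x) -> next (gs j) <= x)].
  have step s : 0 \in s -> all (leq^~ (last 0 s)) s -> Bh_set h s ->
     Bh_set h (rcons s (next s)) /\
     (forall x, last 0 s < x -> Bh_set h (rcons s x) -> next s <= x).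
    move=> s0 sM sB; rewrite /next; set m := last 0 s.
    set p := (fun d => _); set l := iota _ _.
    have hp : has p l.
      apply/hasP; exists (h * m); first by rewrite mem_iota; lia.
      by apply/BhbP/(Bh_set_extend s0 sM _ sB); lia.
    have fl : find p l < (h * m).+1 by rewrite -[X in _ < X](size_iota 0) -has_find.
    split.
      by have /BhbP := nth_find 0 hp; rewrite nth_iota // add0n.
    move=> x mx xB; rewrite leqNgt; apply/negP => xlt.
    have lt : x - m.+1 < find p l by lia.
    have := before_find 0 lt; rewrite nth_iota; last by lia.
    by rewrite add0n /p subnKC // => /BhbP; apply.
  suff [a1 a2 a3] : [/\ 0 \in gs j, all (leq^~ (last 0 (gs j))) (gs j)
                      & Bh_set h (gs j)] by split=> //; apply: step.
  elim: j => [|j [a1 a2 a3]]; first by split=> //; apply: Bh_set01.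
  rewrite gsS last_rcons; split.
  - by rewrite mem_rcons inE a1 orbT.
  - rewrite all_rcons leqnn /=; apply/allP => y /(allP a2) yl.
    by apply: leq_trans yl _; rewrite /next; lia.
  - by have [] := step _ a1 a2 a3.
exists g; split=> // -[//|j] _.
have [_ _ _ [B1 B2]] := inv j.
have gE : g j.+2 = next (gs j) by rewrite /g gsS last_rcons.
rewrite /greedy_candidate gE -gsE; split; last by move=> x []; apply: B2.
by split=> //; rewrite /next /g; lia.
Qed.

Lemma is_greedy_Bh_uniq (h : nat) (g g' : nat -> nat) :
  is_greedy_Bh h g -> is_greedy_Bh h g' -> g =1 g'.
Proof.
move=> [g0 g1 gS] [g0' g1' gS'] k.
elim/ltn_ind: k => -[|[|k]] IH; [by rewrite g0 g0'|by rewrite g1 g1'|].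
have e : mkseq g k.+2 = mkseq g' k.+2.
  by apply/eq_in_map => i; rewrite mem_iota => ik; apply: IH; lia.
have ek : g k.+1 = g' k.+1 by apply: IH.
have [c m] := gS k.+1 isT; have [c' m'] := gS' k.+1 isT.
apply/eqP; rewrite eqn_leq m ?m' //.
  by move: c; rewrite /greedy_candidate e ek.
by move: c'; rewrite /greedy_candidate e ek.
Qed.

(* Main.v *)
(** Write g2 = h + 1, g3 = h^2 + h + 1 and g4 = ceil(h/2) g3 + floor(h/2) g2
    + floor(h/2) + 1. An integer x outside a set containing 0, 1, g2, g3, g4
    cannot extend it to a B_h-set as soon as x = c1 + c2 g2 + c3 g3 + c4 g4 with
    integer coefficients whose positive parts sum to at most h and whose negative
    parts sum to at most h - 1: move the negative terms to the side of x and pad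
    with zeros. Conversely {0, 1, g2, g3, g4} is a B_h-set because no nontrivial
    integer relation between 1, g2, g3, g4 has positive and negative parts both
    of sum at most h. Together these identify gamma_2, gamma_3, gamma_4 as
    g2, g3, g4.

    For x < h^4/8 + h^3/2, divide successively by g4, g3, g2 to get nonnegative
    digits with leading digit q at most about h/4. If the digit sum exceeds h,
    subtracting one of the relations h g2 + 1 = g3, (h + 1) 1 = g2, their sum,
    or the relation defining g4 always yields admissible coefficients, so x is
    not gamma_5. *)

From Stdlib Require Import ZArith.
Require Import Defs.
From mathcomp Require Import all_boot all_order all_algebra.
From mathcomp Require Import zify ring lra.

Import GRing.Theory Num.Theory.

Set Implicit Arguments.
Unset Strict Implicit.
Unset Printing Implicit Defensive.

(** * Integer combinations of 1, g2, g3 and g4 *)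

Section IntegerRelations.

Local Open Scope Z_scope.

Definition pos_sum (a b c d : Z) : Z :=
  Z.max 0 a + Z.max 0 b + Z.max 0 c + Z.max 0 d.

(* k and l stand for the ceiling and the floor of h / 2. *)
Definition halves (h k l : Z) : Prop :=
  [/\ 0 < h, h = k + l & k = l \/ k = l + 1].

Definition Zg3 (h : Z) : Z := h * h + h + 1.

Definition Zg4 (h k l : Z) : Z := k * Zg3 h + l * (h + 1) + (l + 1).

(** Size comparison fixes the coefficients from [c4] down. If [c4 = 0], then [c1 + c2 * g2] is below
    g3 in absolute value, so [c3], [c2] and [c1] vanish in turn. If [c4 = 1], expanding g4 leaves
    [c3 = - k] or [c3 = - k - 1], and each breaks a bound on the parts. *)
Lemma relation_nneg h k l c1 c2 c3 c4 :
  halves h k l -> 0 <= c4 ->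
  pos_sum c1 c2 c3 c4 <= h -> pos_sum (- c1) (- c2) (- c3) (- c4) <= h ->
  c1 + c2 * (h + 1) + c3 * Zg3 h + c4 * Zg4 h k l = 0 ->
  [/\ c1 = 0, c2 = 0, c3 = 0 & c4 = 0].
Proof.
rewrite /Zg4 /Zg3.
rewrite /pos_sum => -[h0 hk he] c40 Pc Nc.
have [c1P c2P c12P] : [/\ c1 + c4 <= h, c2 + c4 <= h & c1 + c2 + c4 <= h] by split; lia.
have [c1N c2N c3N] : [/\ - h <= c1, - h <= c2 & - h <= c3] by split; lia.
have [c12N c13N c23N c123N] : [/\ - h <= c1 + c2, - h <= c1 + c3, - h <= c2 + c3 &
   - h <= c1 + c2 + c3] by split; lia.
have [c13P c23P] : c1 + c3 + c4 <= h /\ c2 + c3 + c4 <= h by split; lia.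
move=> {Pc Nc}.
set g2 := h + 1; set g3 := h * h + h + 1; set g4 := k * g3 + _ + _ => E.
have g2E : g2 = h + 1 by [].
have g3E : g3 = h * g2 + 1 by rewrite /g3 /g2; ring.
have g4E : g4 = k * g3 + l * g2 + (l + 1) by [].
clearbody g4; clearbody g3; clearbody g2.
have g20 : 0 < g2 by lia.
have g23 : h * g2 < g3 by lia.
have g2g3 : g2 <= g3 by clear - g3E g20 h0; nia.
have gl : 0 <= l * g2 by clear -g20 hk he h0; nia.
have g4b : h * g3 < 2 * g4.
  by rewrite g4E hk; clear -he h0 hk gl g20 g2g3; case: he => ->; nia.
have lec123 : - (h * g3) <= c1 + c2 * g2 + c3 * g3.
  have := Z.mul_nonneg_nonneg (c2 + c3 + h) (g2 - 1) ltac:(lia) ltac:(lia).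
  have := Z.mul_nonneg_nonneg (c3 + h) (g3 - g2) ltac:(lia) ltac:(lia).
  by clear -c123N; lia.
have c4lt2 : c4 < 2.
  have [//|c4g] := Z_lt_le_dec c4 2.
  have := Z.mul_le_mono_nonneg_r 2 c4 g4 ltac:(clear -g4b h0 g20 g2g3; nia) c4g.
  by clear -E lec123 g4b; lia.
have lec12 : - (h * g2) <= c1 + c2 * g2 <= (h - c4) * g2.
  have := Z.mul_nonneg_nonneg (c2 + h) (g2 - 1) ltac:(lia) ltac:(lia).
  have := Z.mul_nonneg_nonneg (h - c4 - c2) (g2 - 1) ltac:(lia) ltac:(lia).
  by clear -c12N c12P; lia.
(* Since h g3 < 2 g4, only c4 = 0 and c4 = 1 survive. *)
have [c4E|c4E] : c4 = 0 \/ c4 = 1 by lia.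
  rewrite c4E in E lec12.
  have c3E : c3 = 0 by clear -E lec12 g23; nia.
  rewrite c3E in E.
  have c2E : c2 = 0 by rewrite g2E in E; clear -E c1P c1N c40 h0; nia.
  by rewrite c2E in E; split=> //; lia.
exfalso; rewrite c4E in E lec12 c1P c2P c12P c13P c23P.
have {}E : (c1 + l + 1) + (c2 + l) * g2 + (c3 + k) * g3 = 0.
  by rewrite -[RHS]E g4E; ring.
have l0 : 0 <= l by lia.
have gl2 : l * g2 * 2 <= h * g2 by clear -g20 hk he; nia.
have f1 : c3 + k < 1.
  have [//|f1] := Z_lt_le_dec (c3 + k) 1.
  have := Z.mul_le_mono_nonneg_r 1 (c3 + k) g3 ltac:(lia) f1.
  by clear -E lec12 gl g23 l0 h0 hk he; lia.
have f2 : -2 < c3 + k.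
  have [f2|] := Z_le_gt_dec (c3 + k) (- 2); last by lia.
  have := Z.mul_le_mono_nonneg_r (c3 + k) (- 2) g3 ltac:(lia) f2.
  have := Z.mul_nonneg_nonneg h g2 ltac:(lia) ltac:(lia).
  by clear -E lec12 gl2 g23 g2E h0 hk he; lia.
have [c3E|c3E] : c3 = - k \/ c3 = - k - 1 by lia.
  have t0 : 0 <= c2 + l by lia.
  by rewrite c3E in E; clear -E t0 g20 c13N c3E hk; nia.
have t1 : 1 <= c2 + l by lia.
rewrite c3E g3E in E.
have {}E : c1 = g2 * (h - (c2 + l)) - l by lia.
(* A value at most 0 gives [c1 + c3 < - h], and a value above 1 gives [c1 > h]. The value 1 gives
   [c1 = k + 1] and [c2 = k - 1], so that [c1 + c2 + c4 = 2 * k + 1 > h]. *)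
have : h - (c2 + l) <= 0 \/ 1 < h - (c2 + l) \/ h - (c2 + l) = 1 by lia.
case=> [H|[H|H]]; last by rewrite H g2E in E; lia.
  by clear -E H g20 c13N c3E hk; nia.
by rewrite g2E in E; clear -E H c1P hk he h0; nia.
Qed.

Lemma relation_trivial h k l c1 c2 c3 c4 :
  halves h k l ->
  pos_sum c1 c2 c3 c4 <= h -> pos_sum (- c1) (- c2) (- c3) (- c4) <= h ->
  c1 + c2 * (h + 1) + c3 * Zg3 h + c4 * Zg4 h k l = 0 ->
  [/\ c1 = 0, c2 = 0, c3 = 0 & c4 = 0].
Proof.
move=> hkl Pc Nc E; have [c40|c40] := Z_le_gt_dec 0 c4.
  exact: relation_nneg hkl c40 Pc Nc E.
have [|||||] := @relation_nneg h k l (- c1) (- c2) (- c3) (- c4) => //.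
- by lia.
- by rewrite !Z.opp_involutive.
- by lia.
- by move=> *; split; lia.
Qed.

(** The strict bound keeps one of the h places for x itself, next to the negative terms. *)
Definition light (h a b c d : Z) : Prop :=
  pos_sum a b c d <= h /\ pos_sum (- a) (- b) (- c) (- d) < h.

(* Every such x lies in hA - (h - 1)A for A = {0, 1, g2, g3, g4}. *)
Definition light_comb (h g2 g3 g4 x : Z) : Prop :=
  exists c1 c2 c3 c4,
    x = c1 + c2 * g2 + c3 * g3 + c4 * g4 /\ light h c1 c2 c3 c4.

(* The implications say, digit by digit, that
   c1 + c2 g2 < g3 and c1 + c2 g2 + c3 g3 < g4. *)
Definition digits (h k l c1 c2 c3 : Z) : Prop :=
  [/\ 0 <= c1 <= h, 0 <= c2 <= h, c2 = h -> c1 = 0 &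
   [/\ 0 <= c3 <= k, c3 = k -> c2 <= l & c3 = k -> c2 = l -> c1 <= l]].

Lemma digits_exist h k l y : halves h k l -> 0 <= y < Zg4 h k l ->
  exists c1 c2 c3, digits h k l c1 c2 c3 /\
    y = c1 + c2 * (h + 1) + c3 * Zg3 h.
Proof.
move=> [h0 hk hl]; rewrite /Zg4 => -[y0 ylt].
have g3E : Zg3 h = h * (h + 1) + 1 by rewrite /Zg3; ring.
move: g3E ylt; set g2 := h + 1; set g3 := Zg3 h.
have g2E : g2 = h + 1 by [].
clearbody g3; clearbody g2 => g3E ylt.
have g20 : 0 < g2 by lia.
have g30 : 0 < g3 by clear -g3E g20 h0; nia.
have := Z.div_mod y g3 ltac:(lia); have := Z.mod_pos_bound y g3 g30.
move: (y mod g3) (y / g3) => z c3 zb yE.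
have := Z.div_mod z g2 ltac:(lia); have := Z.mod_pos_bound z g2 g20.
move: (z mod g2) (z / g2) => c1 c2 c1b zE.
have l0 : 0 <= l * g2 by clear -g20 h0 hk hl; nia.
have lh : l * g2 + l <= h * g2 by clear -g20 g2E h0 hk hl; nia.
have c20 : 0 <= c2 by clear -zE zb c1b; nia.
have c2h : c2 <= h by clear -zE zb c1b g3E; nia.
have c30 : 0 <= c3 by clear -yE zb y0 g30; nia.
have c3k : c3 <= k by clear -yE zb ylt g30 g3E lh; nia.
exists c1, c2, c3; split; last by clear -yE zE; lia.
split; [lia | lia | | split; first by lia].
- by move=> E; rewrite E in zE; clear -zE zb g3E c1b; lia.
- by move=> E; rewrite E in yE; clear -yE zE ylt c1b g2E h0 hk hl; nia.
- by move=> E E2; rewrite E2 in zE; rewrite E in yE; clear -yE zE ylt; lia.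
Qed.

(** The coefficient of [g4] is always 0, so the result applies to the set {0, 1, g2, g3} alone. *)
Lemma light_comb4 h k l g4 y : halves h k l -> 0 <= y < Zg4 h k l ->
  light_comb h (h + 1) (Zg3 h) g4 y.
Proof.
move=> hkl yb; have [c1 [c2 [c3 [cd ->]]]] := digits_exist hkl yb.
have [h0 hk hl] := hkl; have [b1 b2 b21 [b3 b32 b31]] := cd.
move=> {hkl yb cd}.
have [?|?] := Z_le_gt_dec (c1 + c2 + c3) h.
  by exists c1, c2, c3, 0; split; [ring | rewrite /light /pos_sum; lia].
(* Subtracting both carry relations makes the negative part [2 * h + 1 - (c1 + c2)], which is below
   h exactly under this test. *)
have [?|?] := Z_le_gt_dec (h + 2) (c1 + c2).
  exists (c1 - 1 - (h + 1)), (c2 - h + 1), (c3 + 1), 0.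
  by split; [rewrite /Zg3; ring | rewrite /light /pos_sum; lia].
have [?|?] := Z_le_gt_dec (c1 + c3) h.
  exists (c1 - 1), (c2 - h), (c3 + 1), 0.
  by split; [rewrite /Zg3; ring | rewrite /light /pos_sum; lia].
exists (c1 - (h + 1)), (c2 + 1), c3, 0.
by split; [ring | rewrite /light /pos_sum; lia].
Qed.

(** Trading [l + 1] ones, [l] copies of g2 and [k] copies of g3 for one more g4 usually suffices.
    The exceptional digits are so extreme that an ordinary carry works. *)
Lemma light_comb5 h k l q y : halves h k l -> 0 <= y < Zg4 h k l ->
  0 <= q -> 4 * q <= 2 * l + 1 ->
  light_comb h (h + 1) (Zg3 h) (Zg4 h k l) (q * Zg4 h k l + y).
Proof.
move=> hkl yb q0 ql; have [c1 [c2 [c3 [cd ->]]]] := digits_exist hkl yb.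
have [h0 hk hl] := hkl; have [b1 b2 b21 [b3 b32 b31]] := cd.
move=> {hkl yb cd}.
have [?|?] := Z_le_gt_dec (c1 + c2 + c3 + q) h.
  by exists c1, c2, c3, q; split; [ring | rewrite /light /pos_sum; lia].
have opt2 : light h (c1 - (l + 1)) (c2 - l) (c3 - k) (q + 1) ->
  light_comb h (h + 1) (Zg3 h) (Zg4 h k l)
    (q * Zg4 h k l + (c1 + c2 * (h + 1) + c3 * Zg3 h)).
  by move=> ?; do 4 eexists; split; last eassumption; rewrite /Zg4; ring.
(* These tests give the signs of the first two coefficients after the trade. In the first three
   cases the next test bounds, in turn, the positive part [c1 + c2 + q - 2 * l], the negative part
   [h - (c2 + c3)] and the negative part [h + 1 - (c1 + c3)]. *)
have [?|?] := Z_le_gt_dec (l + 1) c1; have [?|?] := Z_le_gt_dec l c2.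
- have [?|?] := Z_le_gt_dec (c1 + c2 + q) (2 * h - (k - l)).
    by apply: opt2; rewrite /light /pos_sum; lia.
  exists (c1 - 1 - (h + 1)), (c2 - h + 1), (c3 + 1), q.
  by split; [rewrite /Zg3; ring | clear opt2; rewrite /light /pos_sum; lia].
- have [?|?] := Z_le_gt_dec 1 (c2 + c3).
    by apply: opt2; rewrite /light /pos_sum; lia.
  exists (c1 - (h + 1)), (c2 + 1), c3, q.
  by split; [ring | clear opt2; rewrite /light /pos_sum; lia].
- have [?|?] := Z_le_gt_dec 2 (c1 + c3).
    by apply: opt2; rewrite /light /pos_sum; lia.
  exists (c1 - 1), (c2 - h), (c3 + 1), q.
  by split; [rewrite /Zg3; ring | clear opt2; rewrite /light /pos_sum; lia].
- by apply: opt2; rewrite /light /pos_sum; lia.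
Qed.

(** If [8 * x] is less than the left side, the quotient q of x by g4 satisfies [2 * q < l + 1],
    which is the condition on [q] in [light_comb5]. *)
Lemma Zg4_bound h k l : halves h k l ->
  h * h * h * h + 4 * (h * h * h) <= 4 * (l + 1) * Zg4 h k l.
Proof.
move=> [h0 hk hl]; rewrite /Zg4 /Zg3; rewrite {}hk in h0 *.
case: hl => kl; rewrite {}kl in h0 *.
  suff : 0 <= 28 * (l * l) + 16 * l + 4 by lia.
  by nia.
have l0 : 0 <= l by lia.
suff : 0 <= 24 * (l * l) + 32 * l + 11 by lia.
by nia.
Qed.

Lemma light_comb_below h k l x : halves h k l -> 0 <= x ->
  8 * x < h * h * h * h + 4 * (h * h * h) ->
  light_comb h (h + 1) (Zg3 h) (Zg4 h k l) x.
Proof.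
move=> hkl x0 xlt.
have g4b := Zg4_bound hkl.
have g40 : 0 < Zg4 h k l.
  by case: hkl => h0 hk hl; clear -h0 hk hl; rewrite /Zg4 /Zg3; nia.
have := Z.div_mod x (Zg4 h k l) ltac:(lia).
have := Z.mod_pos_bound x (Zg4 h k l) g40.
move: (x mod _) (x / _) => y q yb xE.
have -> : x = q * Zg4 h k l + y by lia.
have q0 : 0 <= q by clear -xE yb g40 x0; nia.
apply: light_comb5 => //.
have [//|ql] := Z_le_gt_dec (4 * q) (2 * l + 1).
have := Z.mul_le_mono_nonneg_r (4 * (l + 1)) (8 * q) (Zg4 h k l) ltac:(lia) ltac:(lia).
by clear -g4b xE yb xlt; lia.
Qed.

End IntegerRelations.

(** * From integer combinations to multisets of summands *)

Lemma Bh_conflict h (s p n : seq nat) x :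
  0 \in s -> x \notin s -> {subset p <= s} -> {subset n <= s} ->
  size p <= h -> size n < h -> x + sumn n = sumn p ->
  ~ Bh_set h (rcons s x).
Proof.
move=> s0 xs ps ns sp sn E /Bh_setP H.
have sub r : {subset r <= s} -> {subset r <= rcons s x}.
  by move=> rs y /rs ys; rewrite mem_rcons inE ys orbT.
have pad j r : {subset r <= s} -> {subset r ++ nseq j 0 <= s}.
  move=> rs y; rewrite mem_cat => /orP[/rs//|].
  by rewrite mem_nseq => /andP[_ /eqP->].
have /perm_mem/(_ x) :
    perm_eq (x :: n ++ nseq (h - (size n).+1) 0) (p ++ nseq (h - size p) 0).
  apply: H.
  - by rewrite /= size_cat size_nseq; lia.
  - by rewrite size_cat size_nseq; lia.
  - move=> y; rewrite inE => /orP[/eqP->|].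
      by rewrite mem_rcons mem_head.
    by apply: sub; apply: pad.
  - by apply: sub; apply: pad.
  - by rewrite /= !sumn_cat !sumn_nseq !mul0n !addn0.
by rewrite mem_head => /esym/(pad _ _ ps); rewrite (negPf xs).
Qed.

Lemma light_comb_conflict h (s : seq nat) g2 g3 g4 x :
  {subset [:: 0; 1; g2; g3; g4] <= s} -> x \notin s ->
  light_comb (Z.of_nat h) (Z.of_nat g2) (Z.of_nat g3) (Z.of_nat g4)
    (Z.of_nat x) ->
  ~ Bh_set h (rcons s x).
Proof.
move=> gs xs [c1 [c2 [c3 [c4 [E [Pc Nc]]]]]].
(* Since [Z.to_nat] truncates at 0, [comb] keeps the positive parts; applied to the opposite
   coefficients it gives the negative parts. *)
pose comb c := nseq (Z.to_nat (c 1)) 1 ++ nseq (Z.to_nat (c 2)) g2 ++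
  nseq (Z.to_nat (c 3)) g3 ++ nseq (Z.to_nat (c 4)) g4.
have combs c : {subset comb c <= s}.
  move=> y yc; apply: gs; move: yc; rewrite !mem_cat !mem_nseq !inE.
  by case/or4P => /andP[_ ->]; rewrite ?orbT.
pose c i := nth Z0 [:: c1; c2; c3; c4] i.-1.
apply: (@Bh_conflict h s (comb c) (comb (fun i => Z.opp (c i)))) => //.
- by apply: gs; rewrite mem_head.
- by move: Pc; rewrite /comb !size_cat !size_nseq /c /pos_sum /=; lia.
- by move: Nc; rewrite /comb !size_cat !size_nseq /c /pos_sum /=; lia.
- rewrite /comb !sumn_cat !sumn_nseq /c /= !mul1n.
  have split (g : nat) (z : Z) : Z.sub (Z.of_nat (g * Z.to_nat z))
      (Z.of_nat (g * Z.to_nat (Z.opp z))) = Z.mul z (Z.of_nat g).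
    by clear; nia.
  have := split 1 c1; have := split g2 c2; have := split g3 c3.
  have := split g4 c4; rewrite !mul1n; move: E; clear; lia.
Qed.

(** With [F] the identity or the constant 1, this reads the sum or the size of [a] from its
    multiplicities. *)
Lemma sum_count_mem (s a : seq nat) (F : nat -> nat) :
  uniq s -> {subset a <= s} ->
  \sum_(x <- a) F x = \sum_(y <- s) count_mem y a * F y.
Proof.
move=> us; elim: a => [|x a IH] sub.
  by rewrite big_nil big1.
rewrite big_cons IH; last by move=> y ya; apply: sub; rewrite inE ya orbT.
under [RHS]eq_bigr do rewrite /= mulnDl.
rewrite big_split /=; congr (_ + _).
rewrite (bigD1_seq x) ?sub ?mem_head //= eqxx mul1n big1 ?addn0 // => y.
by rewrite eq_sym => /negPf->.
Qed.

(** * The greedy elements up to gamma_4 and the bound on gamma_5 *)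

Definition greedy3 (h : nat) : nat := h * h + h + 1.

Definition greedy4 (h : nat) : nat :=
  uphalf h * greedy3 h + h./2 * h.+1 + h./2.+1.

Lemma halves_nat h : 0 < h ->
  halves (Z.of_nat h) (Z.of_nat (uphalf h)) (Z.of_nat h./2).
Proof.
move=> h0; have := odd_double_half h; rewrite uphalf_half -muln2.
by case: (odd h); move: h./2 => l hE; split; lia.
Qed.

Lemma Zg3_nat h : Z.of_nat (greedy3 h) = Zg3 (Z.of_nat h).
Proof. by rewrite /greedy3 /Zg3; lia. Qed.

Lemma Zg4_nat h : Z.of_nat (greedy4 h) =
  Zg4 (Z.of_nat h) (Z.of_nat (uphalf h)) (Z.of_nat h./2).
Proof.
by rewrite /greedy4 /Zg4 -Zg3_nat; move: (uphalf h) (h./2) (greedy3 h); lia.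
Qed.

Lemma ltn_greedy3 h : 0 < h -> h.+1 < greedy3 h.
Proof. by rewrite /greedy3; nia. Qed.

Lemma ltn_greedy4 h : 0 < h -> greedy3 h < greedy4 h.
Proof.
move=> h0; rewrite /greedy4.
have : 0 < uphalf h by case: h h0 => [|[|h]].
by move: (uphalf h) (h./2) (greedy3 h); nia.
Qed.

(** The differences of multiplicities of the nonzero elements form an integer relation, hence
    vanish; equal sizes then settle the multiplicity of 0. *)
Lemma Bh_set_greedy4 h : 0 < h ->
  Bh_set h [:: 0; 1; h.+1; greedy3 h; greedy4 h].
Proof.
move=> h0; set s := [:: 0; _; _; _; _].
have g3 := ltn_greedy3 h0; have g4 := ltn_greedy4 h0.
have us : uniq s by rewrite /= !inE; lia.
have hkl := halves_nat h0.
apply/Bh_setP => a b sa sb aA bA E.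
have cnt r : {subset r <= s} ->
    (sumn r = count_mem 1 r + count_mem h.+1 r * h.+1 +
       count_mem (greedy3 h) r * greedy3 h + count_mem (greedy4 h) r * greedy4 h) /\
    (size r = count_mem 0 r + count_mem 1 r + count_mem h.+1 r +
       count_mem (greedy3 h) r + count_mem (greedy4 h) r).
  move=> rA; rewrite sumnE -sum1_size !(sum_count_mem _ us rA) /s.
  by rewrite !big_cons !big_nil !muln1 muln0 !addn0 !addnA.
have [a1 a2] := cnt _ aA; have [b1 b2] := cnt _ bA.
rewrite a1 b1 {a1 b1} in E; rewrite sa {sa cnt} in a2; rewrite sb {sb} in b2.
have [] := @relation_trivial _ _ _
  (Z.of_nat (count_mem 1 a) - Z.of_nat (count_mem 1 b))
  (Z.of_nat (count_mem h.+1 a) - Z.of_nat (count_mem h.+1 b))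
  (Z.of_nat (count_mem (greedy3 h) a) - Z.of_nat (count_mem (greedy3 h) b))
  (Z.of_nat (count_mem (greedy4 h) a) - Z.of_nat (count_mem (greedy4 h) b)) hkl.
- by rewrite /pos_sum; clear -a2 b2; lia.
- by rewrite /pos_sum; clear -a2 b2; lia.
- by rewrite -Zg3_nat -Zg4_nat; clear -E; lia.
move=> e1 e2 e3 e4; apply/allP => x; rewrite mem_cat => xab.
have : x \in s by case/orP: xab; [apply: aA|apply: bA].
by rewrite !inE => /or4P[||| /orP[]] /eqP->; apply/eqP; clear -a2 b2 e1 e2 e3 e4; lia.
Qed.

Lemma greedy_next h gamma k s v : is_greedy_Bh h gamma -> 0 < k ->
  mkseq gamma k.+1 = s -> gamma k < v -> Bh_set h (rcons s v) ->
  (forall x, gamma k < x < v -> ~ Bh_set h (rcons s x)) ->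
  gamma k.+1 = v.
Proof.
move=> [_ _ /(_ k) G] k0 sE kv vB min; have [[lt B] le] := G k0.
rewrite sE in B; apply/eqP; rewrite eqn_leq le /=; last by split; rewrite ?sE.
by rewrite leqNgt; apply/negP => lt'; apply: (min (gamma k.+1)); rewrite ?lt.
Qed.

Lemma greedy_values h gamma : 0 < h -> is_greedy_Bh h gamma ->
  [/\ gamma 2 = h.+1, gamma 3 = greedy3 h & gamma 4 = greedy4 h].
Proof.
move=> h0 G; have [g0 g1 _] := G; have hkl := halves_nat h0.
have lt3 := ltn_greedy3 h0; have lt4 := ltn_greedy4 h0.
have B2 : Bh_set h [:: 0; 1; h.+1].
  by apply: (@Bh_set_extend h [:: 0; 1] 1) => //; [lia | apply: Bh_set01].
have g2 : gamma 2 = h.+1.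
  apply: (greedy_next (s := [:: 0; 1]) G) => //.
  - by rewrite /mkseq /= g0 g1.
  - by rewrite g1.
  - rewrite g1 => x /andP[x1 xh].
    (* Here [x <= h], so x is already a sum of at most h ones. *)
    apply: (@Bh_conflict _ _ (nseq x 1) [::]) => //.
    + by rewrite !inE; lia.
    + by move=> y; rewrite mem_nseq => /andP[_ /eqP->].
    + by rewrite size_nseq.
    + by rewrite sumn_nseq /=; lia.
have g3 : gamma 3 = greedy3 h.
  apply: (greedy_next (s := [:: 0; 1; h.+1]) G) => //.
  - by rewrite /mkseq /= g0 g1 g2.
  - by rewrite g2.
  - apply: (@Bh_set_extend h [:: 0; 1; h.+1] h.+1) => //.
      by rewrite /=; lia.
    by rewrite /greedy3; lia.
  - rewrite g2 => x /andP[x2 x3].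
    (* The elements not yet present are replaced by 0, which belongs to the set. *)
    apply: (@light_comb_conflict _ _ h.+1 0 0).
    + by move=> y; rewrite !inE => /or4P[||| /orP[]] ->; rewrite ?orbT.
    + by rewrite !inE; lia.
    + have := Z.div_mod (Z.of_nat x) (Z.of_nat h.+1) ltac:(lia).
      have := Z.mod_pos_bound (Z.of_nat x) (Z.of_nat h.+1) ltac:(lia).
      move: (Z.modulo _ _) (Z.div _ _) => c1 c2 c1b xE.
      have c2b : Z.le 0 c2 /\ Z.le c2 (Z.of_nat h).
        by move: x3; rewrite /greedy3 => x3; clear -x3 xE c1b; nia.
      have c21 : c2 = Z.of_nat h -> c1 = Z0.
        by move: x3; rewrite /greedy3 => x3 E; rewrite E in xE; clear -x3 xE c1b; lia.
      have [?|c12] := Z_le_gt_dec (Z.add c1 c2) (Z.of_nat h).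
        by exists c1, c2, Z0, Z0; split; rewrite /light /pos_sum; lia.
      (* A digit sum above h is repaired by trading [h + 1] ones for one g2. *)
      exists (Z.sub c1 (Z.of_nat h.+1)), (Z.succ c2), Z0, Z0.
      by split; rewrite /light /pos_sum; clear -xE c1b c2b c21 c12; lia.
split=> //.
apply: (greedy_next (s := [:: 0; 1; h.+1; greedy3 h]) G) => //.
- by rewrite /mkseq /= g0 g1 g2 g3.
- by rewrite g3.
- exact: Bh_set_greedy4.
- rewrite g3 => x /andP[x3 x4].
  apply: (@light_comb_conflict _ _ h.+1 (greedy3 h) 0).
  + by move=> y; rewrite !inE => /or4P[||| /orP[]] ->; rewrite ?orbT.
  + by rewrite !inE; lia.
  + rewrite Zg3_nat Nat2Z.inj_succ; apply: light_comb4 hkl _.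
    by rewrite -Zg4_nat; lia.
Qed.

Theorem theorem2 (h : nat) (gamma : nat -> nat) :
  (0 < h)%N -> is_greedy_Bh h gamma ->
  (1 / 8 * h%:R ^+ 4 + 1 / 2 * h%:R ^+ 3 <= (gamma 5%N)%:R :> rat)%R.
Proof.
move=> h0 G; have [g2 g3 g4] := greedy_values h0 G; have [g0 g1 Gk] := G.
have lt3 := ltn_greedy3 h0; have lt4 := ltn_greedy4 h0.
suff : h ^ 4 + 4 * h ^ 3 <= 8 * gamma 5.
  by rewrite -(ler_nat rat) natrD natrX (natrM _ 4) (natrM _ 8) natrX; lra.
rewrite leqNgt; apply/negP => lt5; have [[lt45 B] _] := Gk 4 isT.
rewrite g4 in lt45; move: B; rewrite /mkseq /= g0 g1 g2 g3 g4.
apply: (@light_comb_conflict _ [:: 0; 1; h.+1; greedy3 h; greedy4 h]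
  h.+1 (greedy3 h) (greedy4 h)) => //.
- by rewrite !inE; lia.
- rewrite Zg3_nat Zg4_nat Nat2Z.inj_succ.
  apply: light_comb_below (halves_nat h0) _ _; first by lia.
  by move: lt5; rewrite !expnS expn0; clear; lia.
Qed.
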